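(* Let $q$ be a prime number, let $m \ge 2$ be a divisor of $q-1$ and let $s \in \mathbb Z_q^*$ with $\mathrm{ord}_q(s) = m$, where $(m,q) \neq (2,3)$. Let $C_q \rtimes_s C_m$ be the group generated by $x$ and $y$ with relations $x^m = 1$, $y^q = 1$, $yx = xy^s$. Let $S$ be a sequence in $C_q \rtimes_s C_m$ with $m+q-2$ elements. Then the following are equivalent: (i) $S$ is free of product-$1$ subsequences; (ii) for some $1 \le t \le q-1$, some $1 \le i \le m-1$ with $\gcd(i,m) = 1$, and some $0 \le \nu_1, \dots, \nu_{m-1} \le q-1$, the sequence $S$ is (up to the order of its terms) $$S = ( \underbrace{y^t, y^t, \dots, y^t}_{q-1\text{ times}}, x^iy^{\nu_1}, x^iy^{\nu_2}, \dots, x^iy^{\nu_{m-1}} ).$$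
   Context: A sequence in a finite group $G$ (written multiplicatively) is a finite list of elements of $G$, repetition allowed. A subsequence $T=(g_{n_1},\dots,g_{n_k})$ (with $\{n_1,\dots,n_k\}$ a non-empty subset of the index set) is a product-$1$ subsequence if $g_{\sigma(n_1)}g_{\sigma(n_2)}\cdots g_{\sigma(n_k)} = 1$ for some permutation $\sigma$ of $\{n_1,\dots,n_k\}$. $S$ is free of product-$1$ subsequences if it has no non-empty product-$1$ subsequence. *)

(* Defs.v *)
From mathcomp Require Import all_boot all_fingroup.
Set Implicit Arguments. Unset Strict Implicit. Unset Printing Implicit Defensive.
Local Open Scope group_scope.

Definition product_one_free (gT : finGroupType) (S : seq gT) : Prop :=
  forall (b : bitseq) (t : seq gT),
    perm_eq t (mask b S) -> t != [::] -> \prod_(g <- t) g != 1.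

Definition mult_order_mod (q s m : nat) : Prop :=
  [/\ 0 < m, s ^ m = 1 %[mod q] & forall k, 0 < k < m -> s ^ k <> 1 %[mod q]].

(* Main.v *)
(* Write H = <y>, so that G / H is cyclic of order m and every h <> 1 in H has
   centralizer H in G.  Call a list with product in H a block when no proper
   nonempty part of it has its product in H.  The products of the rearrangements
   of a block T include its cyclic rotations, which are conjugates of one element
   of H by elements distinct modulo H; so a free block yields at least |T| products,
   and by Cauchy-Davenport disjoint blocks of S have total length at most q - 1.
   What a maximal family of blocks leaves over maps to a product-one free list
   of G / H of length at least, hence exactly, m - 1; so it lies in one coset uH
   that generates G / H, where u is the inverse of the image of the product of S
   and so does not depend on the family.
   Counting modulo m, every term of S is in H or in uH, and the number of terms in
   uH is m - 1 modulo m.  If it were at least 2m - 1, then 2m - 1 of these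
   terms would have more than m products of length m (pair unequal terms and apply
   Cauchy-Davenport, gaining one in the first step by choosing the order), again
   contradicting Cauchy-Davenport in H unless (m, q) = (2, 3).  So exactly m - 1
   terms are in uH, and the q - 1 terms in H form a maximal free list of C_q. *)
Require Import Defs.
From mathcomp Require Import all_boot all_fingroup.
From mathcomp Require Import cyclic zify.
Set Implicit Arguments. Unset Strict Implicit. Unset Printing Implicit Defensive.
Local Open Scope group_scope.

(** * Products of lists and product-one free lists *)

Definition prodl (gT : finGroupType) (s : seq gT) : gT := \prod_(g <- s) g.

Lemma prodl_nil (gT : finGroupType) : prodl [::] = 1 :> gT.
Proof. exact: big_nil. Qed.

Lemma prodl_cons (gT : finGroupType) (g : gT) s : prodl (g :: s) = g * prodl s.
Proof. exact: big_cons. Qed.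

Lemma prodl_cat (gT : finGroupType) (s t : seq gT) :
  prodl (s ++ t) = prodl s * prodl t.
Proof. exact: big_cat. Qed.

Lemma prodl_nseq (gT : finGroupType) n (g : gT) : prodl (nseq n g) = g ^+ n.
Proof.
by elim: n => [|n IHn]; rewrite ?prodl_nil //= prodl_cons IHn expgS.
Qed.

Lemma prodl_in (gT : finGroupType) (K : {group gT}) (s : seq gT) :
  {subset s <= K} -> prodl s \in K.
Proof. by move=> sK; rewrite /prodl big_seq; apply: group_prod. Qed.

Lemma prodl_perm (gT : finGroupType) (K : {group gT}) (s t : seq gT) :
  abelian K -> {subset s <= K} -> perm_eq s t -> prodl s = prodl t.
Proof.
move=> cKK; elim: s t => [|a s IHs] t sK; first by rewrite perm_sym => /perm_nilP->.
move=> st; have a_t: a \in t by rewrite -(perm_mem st) mem_head.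
case/splitPr: a_t st => t1 t2 st.
have {}st: perm_eq s (t1 ++ t2).
  by rewrite -(perm_cons a) (permPl st) -[a :: t2]cat1s perm_catCA.
have sK' : {subset s <= K} by move=> g gs; rewrite sK // inE gs orbT.
have t1K : {subset t1 <= K}.
  by move=> g gt; rewrite sK' // (perm_mem st) mem_cat gt.
rewrite prodl_cons (IHs _ sK' st) !prodl_cat prodl_cons !mulgA.
by rewrite (centsP cKK a _ (prodl t1)) ?prodl_in // sK ?mem_head.
Qed.

(** Used to pull a part of an image list in [G / H] back to a part of the original list. *)
Lemma perm_map_lift (T1 T2 : eqType) (f : T1 -> T2) (s : seq T1) (l : seq T2) :
  perm_eq (map f s) l -> exists2 s', perm_eq s s' & l = map f s'.
Proof.
elim: l s => [|b l IHl] s.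
  by case: s => [|a s]; [exists [::] | move/perm_nilP].
move=> sl; have: b \in map f s by rewrite (perm_mem sl) mem_head.
case/mapP=> a a_s bE; rewrite {b}bE in sl *.
have /IHl[s' ss' ->] : perm_eq (map f (rem a s)) l.
  rewrite -(perm_cons (f a)) -(permPr sl) perm_sym -map_cons.
  exact/perm_map/perm_to_rem.
exists (a :: s') => //; rewrite (permPl (perm_to_rem a_s)) perm_cons //.
Qed.

(** A form of product-one freeness without masks: [t] is a subsequence already in the order of
    multiplication and [u] is the rest, so splittings compose by permutation reasoning. *)
Definition unit_product_free (gT : finGroupType) (S : seq gT) : Prop :=
  forall t u, perm_eq S (t ++ u) -> t != [::] -> prodl t != 1.

Lemma product_one_freeP (gT : finGroupType) (S : seq gT) :
  product_one_free S <-> unit_product_free S.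
Proof.
split=> [freeS t u Stu | freeS b t tb].
  have /count_subseqP[s' ss' ts'] : forall g, count_mem g t <= count_mem g S.
    by move=> g; rewrite (seq.permP Stu) count_cat leq_addr.
  by have /subseqP[b _ s'E] := ss'; apply: (freeS b); rewrite -s'E.
have [u Su] := perm_to_subseq (mask_subseq b S).
by apply: (freeS t u); rewrite (permPl Su) perm_cat2r perm_sym.
Qed.

Lemma free_sub (gT : finGroupType) (S t u : seq gT) :
  unit_product_free S -> perm_eq S (t ++ u) -> unit_product_free t.
Proof.
move=> freeS Stu t1 t2 tt; apply: (freeS t1 (t2 ++ u)).
by rewrite (permPl Stu) catA perm_cat2r.
Qed.

(** Two equal partial products would leave, between their end points, a nonempty segment with
    product 1. *)
Lemma partial_prods_uniq (gT : finGroupType) (l : seq gT) :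
  unit_product_free l -> uniq [seq prodl (take j l) | j <- iota 0 (size l).+1].
Proof.
move=> freel; rewrite map_inj_in_uniq ?iota_uniq //.
suff ltP j k : j < k -> k <= size l -> prodl (take j l) != prodl (take k l).
  move=> j k; rewrite !mem_iota /= !add0n !ltnS => lej lek E.
  by case: (ltngtP j k) => // [jk|kj];
    [have := ltP _ _ jk lek | have := ltP _ _ kj lej]; rewrite E eqxx.
move=> jk lek; rewrite -(cat_take_drop j (take k l)) take_takel ?(ltnW jk) //.
rewrite prodl_cat -{1}[prodl (take j l)]mulg1 (inj_eq (mulgI _)) eq_sym.
apply: (freel _ (take j l ++ drop k l)).
  rewrite -{1}(cat_take_drop k l) -{1}(cat_take_drop j (take k l)).
  by rewrite take_takel ?(ltnW jk) // -catA perm_catCA.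
by rewrite -size_eq0 size_drop size_takel // subn_eq0 -ltnNge.
Qed.

(** Pigeonhole: the [size l + 1] partial products, the empty one included, are distinct elements of
    [K]. *)
Lemma free_size (gT : finGroupType) (K : {group gT}) (l : seq gT) :
  {subset l <= K} -> unit_product_free l -> size l < #|K|.
Proof.
move=> lK /partial_prods_uniq/card_uniqP; rewrite size_map size_iota => <-.
apply/subset_leq_card/subsetP=> g /mapP[j _ ->]; apply: prodl_in => h /mem_take.
exact: lK.
Qed.

(* The partial products of a maximal free list [a, b, ...] exhaust the group, so
   [b] is one of them; only [b = a] does not contradict freeness. *)
Lemma free_max_constant (gT : finGroupType) (K : {group gT}) (l : seq gT) a b :
    abelian K -> {subset l <= K} -> unit_product_free l -> size l = #|K|.-1 ->
  a \in l -> b \in l -> a = b.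
Proof.
move=> cKK lK freel szl al bl; apply/eqP; apply: contraT => neq_ab.
have [r l_abr] : exists r, perm_eq l (a :: b :: r).
  exists (rem b (rem a l)); rewrite (permPl (perm_to_rem al)) perm_cons.
  apply: perm_to_rem; move: bl; rewrite (perm_mem (perm_to_rem al)) inE.
  by rewrite eq_sym (negPf neq_ab).
have {}lK : {subset a :: b :: r <= K} by move=> g; rewrite -(perm_mem l_abr); apply: lK.
have {}freel : unit_product_free (a :: b :: r).
  by apply: (free_sub (u := [::]) freel); rewrite cats0.
have {}szl : size (a :: b :: r) = #|K|.-1 by rewrite -(perm_size l_abr).
have bK : b \in K by rewrite lK // !inE eqxx orbT.
have aK : a \in K by rewrite lK // !inE eqxx.
have := partial_prods_uniq freel; set ps := map _ _ => ups.
have: b \in ps.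
  have sub : ps \subset K.
    by apply/subsetP=> g /mapP[j _ ->]; apply: prodl_in => h /mem_take; apply: lK.
  have /subset_cardP/(_ sub) -> // : #|ps| = #|K|.
  by rewrite (card_uniqP ups) size_map size_iota szl prednK ?cardG_gt0.
(* Index 0 gives [b = 1], index 1 gives [b = a], and a larger index gives [b = a * b * p] with [p] a
   partial product of [r]; by commutativity [a * p = 1]. *)
case/mapP=> -[|[|j]] _ /=; rewrite ?prodl_cons ?take0 ?prodl_nil ?mulg1.
- move=> b1; have /negP := freel [:: b] (a :: r) (permEl (perm_catCA [:: a] [:: b] r)) isT.
  by rewrite prodl_cons prodl_nil mulg1 b1.
- by move=> ba; rewrite ba eqxx in neq_ab.
move/eqP; rewrite mulgA (centsP cKK a aK b bK) -mulgA -{1}[b]mulg1 (inj_eq (mulgI b)) eq_sym.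
rewrite -prodl_cons => p1; have := freel (a :: take j r) (b :: drop j r).
rewrite p1; apply=> //.
rewrite cat_cons perm_cons -[b :: r]cat1s -[b :: drop j r]cat1s perm_sym perm_catCA.
by rewrite cat_take_drop.
Qed.

(** * The Cauchy-Davenport inequality in a group of prime order *)

(* The Dyson transform [(A :|: eB) * (B :&: e^-1 A)] shrinks [B] unless [A] is
   stable under a nontrivial element, i.e. [A = H]. *)
Lemma cauchy_davenport (gT : finGroupType) (H : {group gT}) (A B : {set gT}) :
    prime #|H| -> A \subset H -> B \subset H -> A != set0 -> B != set0 ->
  minn #|H| (#|A| + #|B|).-1 <= #|A * B|.
Proof.
move=> prH sAH; have cHH := cyclic_abelian (prime_cyclic prH).
have [n] := ubnP #|B|; elim: n A B sAH => // n IHn A B sAH ltBn sBH A0 B0.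
have [/exists_inP[a aA /exists_inP[b bB]] | stab] := boolP
    [exists a in A, exists b in B, ~~ ((a * b^-1) *: B \subset A)].
  set e := a * b^-1 => nsub; set A' := A :|: e *: B; set B' := B :&: e^-1 *: A.
  have eH : e \in H by rewrite groupM ?groupV ?(subsetP sAH _ aA) // (subsetP sBH).
  have sB' : B' \proper B.
    rewrite properE subsetIl; apply: contra nsub => /subsetIP[_ sBA].
    by apply/subsetP=> _ /lcosetP[g /(subsetP sBA) + ->]; rewrite mem_lcoset invgK.
  have eBH : e *: B \subset H.
    by apply/subsetP=> g /lcosetP[h hB ->]; rewrite groupM // (subsetP sBH).
  have B'0 : B' != set0.
    apply/set0Pn; exists b; rewrite inE bB mem_lcoset invgK.
    by rewrite /e mulgKV.
  (* Translation by [e] carries [B'] onto the intersection of [A] and [e *: B], so what [B] loses is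
     exactly what [A] gains. *)
  have sumE : #|A'| + #|B'| = #|A| + #|B|.
    have -> : #|B'| = #|A :&: e *: B|.
      rewrite -(card_lcoset B' e); congr #|pred_of_set _|.
      apply/setP=> g; rewrite !(inE, mem_lcoset) invgK mulKVg andbC. done.
    by rewrite cardsUI card_lcoset.
  have sA'B' : A' * B' \subset A * B.
    apply/subsetP=> _ /mulsgP[g h gA' hB' ->].
    move: hB'; rewrite inE mem_lcoset invgK => /andP[hB ehA].
    case/setUP: gA' => [gA|]; first by rewrite mem_mulg.
    case/lcosetP=> k kB ->; rewrite (centsP cHH e eH k (subsetP sBH _ kB)).
    rewrite -mulgA (centsP cHH k (subsetP sBH _ kB)) ?mem_mulg //.
    exact: (subsetP sAH).
  rewrite -sumE; apply: leq_trans (subset_leq_card sA'B'); apply: IHn => //.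
  - by rewrite subUset sAH.
  - by apply: leq_trans (proper_card sB') _; rewrite -ltnS.
  - by rewrite (subset_trans _ sBH) // subsetIl.
  - by apply: contra A0; rewrite setU_eq0 => /andP[].
(* No transform shrinks [B], so [A] is stable under right multiplication by all [b^-1 * c] with [b],
   [c] in [B]. If [B] has two elements, one such quotient generates [H] and [A] is all of [H]; if it
   has one, the bound is immediate. *)
have {}stab a b c : a \in A -> b \in B -> c \in B -> a * (b^-1 * c) \in A.
  move=> aA bB cB; move: stab; rewrite negb_exists_in => /forall_inP/(_ a aA).
  rewrite negb_exists_in => /forall_inP/(_ b bB); rewrite negbK => /subsetP; apply.
  by rewrite mulgA mem_lcoset mulKg.
have [b bB] := set0Pn _ B0; have [a aA] := set0Pn _ A0.
have [B1 | /set0Pn[c]] := eqVneq (B :\ b) set0.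
  rewrite (cardsD1 b B) bB B1 cards0 addn1 /= geq_min; apply/orP; right.
  have -> : B = [set b] by apply/eqP; rewrite eqEsubset sub1set bB -setD_eq0 B1 eqxx.
  by rewrite card_rcoset.
rewrite !inE => /andP[neq_cb cB].
have dH : b^-1 * c \in H by rewrite groupM ?groupV ?(subsetP sBH _ bB) // (subsetP sBH).
have /eqP defH : <[b^-1 * c]> == H.
  rewrite eqEcard cycle_subG dH /=; have := order_dvdG dH.
  case/primeP: (prH) => _ /[apply]; rewrite order_eq1 -eq_mulVg1.
  by case/orP=> [/eqP bc|/eqP <- //]; rewrite bc eqxx in neq_cb.
have AH : H \subset A.
  apply/subsetP=> g gH; have: a^-1 * g \in <[b^-1 * c]>.
    by rewrite defH groupM ?groupV ?(subsetP sAH _ aA).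
  case/cycleP=> k /(canRL (mulKVg a)) ->.
  elim: k => [|k IHk]; first by rewrite mulg1.
  by rewrite expgSr mulgA stab.
rewrite geq_min; apply/orP; left.
apply: leq_trans (subset_leq_card AH) _.
rewrite -(card_rcoset A b).
by apply/subset_leq_card/mulgS; rewrite sub1set.
Qed.


(** * Products of one term from each of several lists *)

(** Written as a product of sets so that Cauchy-Davenport applies one factor at a time; the order of
    [ls] matters, as the group need not be abelian. *)
Definition choice_prods (gT : finGroupType) (ls : seq (seq gT)) : {set gT} :=
  \prod_(l <- ls) [set h in l].

Lemma mem_choice_prods (gT : finGroupType) (ls : seq (seq gT)) g :
    g \in choice_prods ls ->
  exists t u, [/\ perm_eq (flatten ls) (t ++ u), size t = size ls & prodl t = g].
Proof.
rewrite /choice_prods; elim: ls g => [|l ls IHls] g.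
  by rewrite big_nil => /set1P->; exists [::], [::]; rewrite prodl_nil.
rewrite big_cons => /mulsgP[a b]; rewrite inE => la /IHls[t [u [ltu szt <-]]] ->.
exists (a :: t), (rem a l ++ u); split; rewrite ?prodl_cons //= ?szt //.
by rewrite (permPl (perm_cat (perm_to_rem la) ltu)) /= perm_cons perm_catCA.
Qed.

(** The four products are distinct: [a * b = a' * b'] and [a * b' = a' * b] amount to the two
    excluded equations, and any other coincidence to [a = a'] or [b = b']. *)
Lemma pair_prods_card (gT : finGroupType) (a a' b b' : gT) :
    a != a' -> b != b' -> a'^-1 * a != b' * b^-1 -> a'^-1 * a != b * b'^-1 ->
  3 < #|[set a; a'] * [set b; b']|.
Proof.
move=> neq_a neq_b neq1 neq2.
suff: uniq [:: a * b; a * b'; a' * b; a' * b'].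
  move/card_uniqP => /= <-; apply/subset_leq_card/subsetP=> g.
  by rewrite !inE => /or4P[] /eqP->; rewrite mem_mulg ?inE ?eqxx ?orbT.
rewrite /= !inE !negb_or !(inj_eq (mulgI _)) !(inj_eq (mulIg _)) neq_a neq_b.
rewrite !andbT /=; apply/andP; split.
  apply: contra neq1 => /eqP E; apply/eqP/(canRL (mulgK _)).
  by rewrite -mulgA E mulKg.
apply: contra neq2 => /eqP E; apply/eqP/(canRL (mulgK _)).
by rewrite -mulgA E mulKg.
Qed.

Lemma mul_coset_sub (gT : finGroupType) (H : {group gT}) (A B : {set gT}) a b :
    b \in 'N(H) -> A \subset a *: H -> B \subset b *: H ->
  A * B \subset (a * b) *: H.
Proof.
move=> nHb sA sB; apply: subset_trans (mulgSS sA sB) _.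
apply/subsetP=> _ /mulsgP[_ _ /lcosetP[h hH ->] /lcosetP[k kH ->] ->].
rewrite mem_lcoset invMg -!mulgA mulKg !mulgA groupMr //.
by rewrite -[_ * h * b]mulgA -conjgE memJ_norm.
Qed.

(** Translating [A] on the left by [a^-1] and [B] on the right by [b^-1] moves both into [H] and
    preserves the size of the product. The right translation is legitimate because [b] normalizes
    [H]. *)
Lemma coset_cauchy_davenport (gT : finGroupType) (H : {group gT})
    (A B : {set gT}) a b :
    prime #|H| -> b \in 'N(H) -> A \subset a *: H -> B \subset b *: H ->
    A != set0 -> B != set0 ->
  minn #|H| (#|A| + #|B|).-1 <= #|A * B|.
Proof.
move=> prH nHb sA sB A0 B0.
rewrite -norm_rlcoset // in sB.
set A' := a^-1 *: A; set B' := B :* b^-1.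
have oA : #|A'| = #|A| by apply: card_lcoset.
have oB : #|B'| = #|B| by apply: card_rcoset.
have -> : #|A * B| = #|A' * B'|.
  by rewrite /A' /B' -mulgA card_lcoset mulgA card_rcoset.
rewrite -oA -oB; apply: cauchy_davenport => //.
- by apply/subsetP=> _ /lcosetP[g /(subsetP sA) + ->]; rewrite mem_lcoset.
- by apply/subsetP=> _ /rcosetP[g /(subsetP sB) + ->]; rewrite mem_rcoset.
- by rewrite -card_gt0 oA card_gt0.
- by rewrite -card_gt0 oB card_gt0.
Qed.

(** Each pair of unequal elements is a two-element factor, so Cauchy-Davenport gains one for it. *)
Lemma card_mul_pairs (gT : finGroupType) (H : {group gT}) (X : {set gT}) x
    (ps : seq (gT * gT)) :
    prime #|H| -> X \subset x *: H -> X != set0 ->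
    (forall p, p \in ps -> [/\ p.1 \in 'N(H), p.2 \in p.1 *: H & p.1 != p.2]) ->
  minn #|H| (#|X| + size ps)
    <= #|X * choice_prods [seq [:: p.1; p.2] | p <- ps]|.
Proof.
move=> prH; elim: ps X x => [|p ps IHps] X x sX X0 ps_ok.
  by rewrite /choice_prods big_nil mulg1 addn0 geq_minr.
have [np1 p2p1 neq_p] := ps_ok p (mem_head _ _).
rewrite /choice_prods /= big_cons mulgA; set P := [set h in _].
have PE : P = [set p.1; p.2] by apply/setP=> g; rewrite !inE.
have sP : P \subset p.1 *: H.
  by rewrite PE subUset !sub1set p2p1 lcoset_refl.
have P0 : P != set0 by apply/set0Pn; exists p.1; rewrite PE !inE eqxx.
have := coset_cauchy_davenport prH np1 sX sP X0 P0.
rewrite PE cards2 neq_p -PE.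
have XP0 : X * P != set0.
  have [[g gX] [h hP]] := (set0Pn _ X0, set0Pn _ P0).
  by apply/set0Pn; exists (g * h); apply: mem_mulg.
have ps_ok' p' : p' \in ps -> [/\ p'.1 \in 'N(H), p'.2 \in p'.1 *: H & p'.1 != p'.2].
  by move=> p'ps; apply: ps_ok; rewrite inE p'ps orbT.
have := IHps _ _ (mul_coset_sub np1 sX sP) XP0 ps_ok'.
have arith k i j n : minn k (i + 2).-1 <= j -> minn k (i + n.+1) <= minn k (j + n).
  by lia.
by move=> le1 /arith le2; apply: leq_trans (le2 _) le1.
Qed.

Lemma perm_flatten_zip (T : eqType) (s t : seq T) :
  size s = size t ->
  perm_eq (flatten [seq [:: p.1; p.2] | p <- zip s t]) (s ++ t).
Proof.
elim: s t => [|a s IHs] [|b t] //= [/IHs st].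
by rewrite perm_cons perm_sym -cat1s perm_catCA /= perm_cons perm_sym.
Qed.

(** In sorted order, the entries at positions [j] and [j + k] are paired and the last entry is left
    over. Equality within a pair would force the [k + 1] entries from [j] to [j + k] to coincide,
    against the bound on multiplicities. *)
Lemma distinct_pairing (T : finType) (L : seq T) k :
    size L = k.*2.+1 -> (forall x, count_mem x L <= k) ->
  exists (g : T) (ps : seq (T * T)),
    [/\ perm_eq L (g :: flatten [seq [:: p.1; p.2] | p <- ps]), size ps = k &
        forall p, p \in ps -> p.1 != p.2].
Proof.
move=> szL cntL; pose leT (x y : T) := enum_rank x <= enum_rank y.
have leT_tr : transitive leT by move=> y x z; apply: leq_trans.
have leT_tot : total leT by move=> x y; apply: leq_total.
have leT_anti x y : leT x y -> leT y x -> x = y.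
  by move=> xy yx; apply/enum_rank_inj/val_inj/eqP; rewrite eqn_leq; apply/andP.
set w := sort leT L; have wL : perm_eq L w by rewrite perm_sym perm_sort.
have sorted_w : sorted leT w by apply: sort_sorted.
have szw : size w = k.*2.+1 by rewrite size_sort.
case: L => [|x0 L'] // in szL cntL w wL sorted_w szw *.
pose A := take k w; pose B := take k (drop k w).
have szA : size A = k by rewrite size_takel // szw; lia.
have szB : size B = k by rewrite size_takel // size_drop szw; lia.
have wE : w = A ++ B ++ [:: nth x0 w k.*2].
  rewrite -{1}(cat_take_drop k w) -{1}(cat_take_drop k (drop k w)) drop_drop.
  by rewrite addnn (@drop_nth _ x0 k.*2) ?szw // (@drop_oversize _ k.*2.+1) ?szw.
exists (nth x0 w k.*2), (zip A B); split.
- rewrite (permPl wL) {1}wE catA perm_catC /= perm_cons perm_sym.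
  exact: perm_flatten_zip (etrans szA (esym szB)).
- by rewrite size_zip szA szB minnn.
move=> p /(nthP (x0, x0))[j]; rewrite size_zip szA szB minnn => ltjk <-.
rewrite nth_zip ?szA ?szB //= nth_take // nth_take // nth_drop.
apply/eqP=> E; have := cntL (nth x0 w j); rewrite leqNgt => /negP; apply.
rewrite (seq.permP wL) -{2}(cat_take_drop j w) count_cat.
rewrite -(cat_take_drop k.+1 (drop j w)) count_cat.
suff alljk : all (pred1 (nth x0 w j)) (take k.+1 (drop j w)).
  move: alljk; rewrite all_count size_takel ?size_drop ?szw; last by lia.
  by move=> /eqP c_k; rewrite [X in _ < _ + (X + _)]c_k; lia.
apply/(all_nthP x0) => i; rewrite size_takel ?size_drop ?szw; last by lia.
move=> lti; rewrite nth_take // nth_drop /=; apply/eqP.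
have le_nth a b : a <= b -> b < k.*2.+1 -> leT (nth x0 w a) (nth x0 w b).
  move=> leab ltb; apply: sorted_leq_nth; rewrite ?inE ?szw //; last by lia.
  by move=> z; apply: leqnn.
by apply: leT_anti; [rewrite E|]; apply: le_nth; lia.
Qed.


(** Masks of fixed length form a finite type, which makes it possible to search for a subsequence
    and to choose a shortest one. *)
Lemma perm_catP_mask (T : eqType) (s t u : seq T) :
  perm_eq s (t ++ u) -> exists b : (size s).-tuple bool, perm_eq t (mask b s).
Proof.
move=> stu; have /count_subseqP[s' /subseqP[b szb ->] ts'] :
    forall g, count_mem g t <= count_mem g s.
  by move=> g; rewrite (seq.permP stu) count_cat leq_addr.
by have /eqP szb' := szb; exists (Tuple szb').
Qed.

(** * Minimal blocks with product in the kernel [H] *)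

Section ZeroSumBlocks.

Variables (gT : finGroupType) (G H : {group gT}).
Hypotheses (nHG : H <| G) (prH : prime #|H|) (cGH : abelian (G / H)).
(* With the previous hypotheses: [G] is a Frobenius group with kernel [H]. *)
Hypothesis regH : forall g h, g \in G -> h \in H^# -> commute g h -> g \in H.

Let sHG : H \subset G. Proof. exact: normal_sub. Qed.
Let sGN : G \subset 'N(H). Proof. exact: normal_norm. Qed.

Lemma coset_eq1 g : g \in G -> (coset H g == 1) = (g \in H).
Proof.
move=> gG; apply/eqP/idP => [|/coset_id //].
by apply: coset_idr; rewrite (subsetP sGN).
Qed.

Lemma coset_prodl (s : seq gT) : {subset s <= G} ->
  coset H (prodl s) = prodl (map (coset H) s).
Proof.
elim: s => [|g s IHs] sG; first by rewrite !prodl_nil morph1.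
have sG' : {subset s <= G} by move=> k ks; rewrite sG // inE ks orbT.
rewrite /= !prodl_cons -IHs // morphM // (subsetP sGN) ?prodl_in //.
by rewrite sG ?mem_head.
Qed.

Lemma coset_prodl_perm (s t : seq gT) : {subset s <= G} -> perm_eq s t ->
  coset H (prodl s) = coset H (prodl t).
Proof.
move=> sG st; have tG : {subset t <= G} by move=> g; rewrite -(perm_mem st); apply: sG.
rewrite !coset_prodl //; apply: (prodl_perm cGH); last exact: perm_map.
by move=> _ /mapP[g gs ->]; rewrite mem_quotient ?sG.
Qed.

Lemma prodl_perm_mem (s t : seq gT) : {subset s <= G} -> perm_eq s t ->
  (prodl s \in H) = (prodl t \in H).
Proof.
move=> sG st; have tG : {subset t <= G} by move=> g; rewrite -(perm_mem st); apply: sG.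
by rewrite -!coset_eq1 ?prodl_in // (coset_prodl_perm sG st).
Qed.

Definition minimal_block (T : seq gT) : Prop :=
  [/\ T != [::], {subset T <= G}, prodl T \in H &
      forall t u, perm_eq T (t ++ u) -> t != [::] -> u != [::] -> prodl t \notin H].

Definition perm_prods (T : seq gT) : {set gT} :=
  [set g in [seq prodl t | t <- permutations T]].

Lemma perm_prodsP (T : seq gT) g :
  reflect (exists2 t, perm_eq T t & prodl t = g) (g \in perm_prods T).
Proof.
rewrite inE; apply: (iffP mapP) => -[t]; first by rewrite mem_permutations perm_sym; exists t.
by move=> Tt <-; exists t; rewrite // mem_permutations perm_sym.
Qed.

(* The [size T] cyclic rotations of [T] give the conjugates of [prodl T] by the
   partial products, which are distinct modulo [H = 'C_G[prodl T]]. *)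
Lemma card_perm_prods (T : seq gT) :
  minimal_block T -> 1 \notin perm_prods T -> size T <= #|perm_prods T|.
Proof.
case=> T0 TG TH minT T1; set n := size T.
have rotE j : prodl (rot j T) = prodl T ^ prodl (take j T).
  rewrite /rot prodl_cat -{3}(cat_take_drop j T) prodl_cat conjgE.
  by rewrite !mulgA mulVg mul1g.
have uniq_rot : uniq [seq prodl (rot j T) | j <- iota 0 n].
  rewrite map_inj_in_uniq ?iota_uniq //.
  suff ltP j k : j < k -> k < n -> prodl (rot j T) != prodl (rot k T).
    move=> j k; rewrite !mem_iota /= !add0n => ltj ltk E.
    by case: (ltngtP j k) => // [jk|kj];
      [have := ltP _ _ jk ltk | have := ltP _ _ kj ltj]; rewrite E eqxx.
  move=> jk ltk; apply/eqP; rewrite !rotE.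
  set w := drop j (take k T).
  have takeE : take k T = take j T ++ w.
    by rewrite -{1}(cat_take_drop j (take k T)) take_takel // ltnW.
  have wG : {subset w <= G} by move=> g /mem_drop/mem_take; apply: TG.
  rewrite takeE prodl_cat conjgM => E.
  (* Equality of the two rotations says that the segment [w] between [j] and [k] centralizes a
     nontrivial element of [H]; minimality of [T] forbids its product to lie in [H]. *)
  have wH : prodl w \in H.
    apply: (regH (h := prodl T ^ prodl (take j T))); first exact: prodl_in.
      rewrite !inE -rotE; apply/andP; split; last first.
        rewrite -(prodl_perm_mem TG) // perm_sym perm_rot //.
      apply: contra T1 => /eqP p1; apply/perm_prodsP; exists (rot j T) => //.
      by rewrite perm_sym perm_rot.
    by apply/commute_sym/commgP; rewrite commgEl -E mulVg.
  suff /negP[] : prodl w \notin H by [].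
  apply: (minT w (take j T ++ drop k T)).
  - by rewrite perm_sym perm_catCA catA -takeE cat_take_drop.
  - by rewrite -size_eq0 size_drop size_takel ?(ltnW ltk) // subn_eq0 -ltnNge.
  by rewrite -size_eq0 size_cat size_drop -/n; move: ltk; clear; lia.
rewrite -[n](size_iota 0) -(size_map (fun j => prodl (rot j T))) -(card_uniqP uniq_rot).
apply/subset_leq_card/subsetP=> _ /mapP[j _ ->]; apply/perm_prodsP.
by exists (rot j T); rewrite // perm_sym perm_rot.
Qed.

Lemma perm_prods_sub T : minimal_block T -> perm_prods T \subset H.
Proof.
case=> _ TG TH _; apply/subsetP=> _ /perm_prodsP[t Tt <-].
by rewrite -(prodl_perm_mem TG Tt).
Qed.

(** The element 1 stands for omitting the block; otherwise all its terms are used, in some order. *)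
Definition block_sums (Ts : seq (seq gT)) : {set gT} :=
  \prod_(T <- Ts) (1 |: perm_prods T).

Lemma mem_block_sums Ts g : g \in block_sums Ts ->
  exists t u, perm_eq (flatten Ts) (t ++ u) /\ prodl t = g.
Proof.
rewrite /block_sums; elim: Ts g => [|T Ts IHTs] g.
  by rewrite big_nil => /set1P->; exists [::], [::]; rewrite prodl_nil.
rewrite big_cons => /mulsgP[a b aT /IHTs[t [u [ltu <-]]] ->].
case/setU1P: aT => [->|/perm_prodsP[t' Tt' <-]].
  exists t, (T ++ u); rewrite mul1g; split=> //=.
  by rewrite perm_sym perm_catCA perm_cat2l perm_sym.
by exists (t' ++ t), u; rewrite prodl_cat -catA; split=> //=; apply: perm_cat.
Qed.

(** Since 1 is not a rearranged product of [T], the factor of [T] has at least [size T + 1]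
    elements, and Cauchy-Davenport adds up the excesses over one. *)
Lemma card_block_sums Ts :
    (forall T, T \in Ts -> minimal_block T /\ 1 \notin perm_prods T) ->
  block_sums Ts \subset H /\ minn #|H| (size (flatten Ts)).+1 <= #|block_sums Ts|.
Proof.
rewrite /block_sums; elim: Ts => [|T Ts IHTs] Ts_ok.
  by rewrite big_nil sub1G cards1 /= geq_minr.
have [minT T1] := Ts_ok T (mem_head _ _).
have {IHTs} [|sB leB] := IHTs.
  by move=> T' T'Ts; apply: Ts_ok; rewrite inE T'Ts orbT.
rewrite big_cons; set A := 1 |: _; set B := \prod_(_ <- _) _ in sB leB *.
have sA : A \subset H by rewrite subUset sub1set group1 perm_prods_sub.
split; first by rewrite -(mulGid H) mulgSS.
have oA : size T < #|A| by rewrite cardsU1 T1 add1n ltnS card_perm_prods.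
have A0 : A != set0 by rewrite -card_gt0; apply: leq_trans oA.
have B0 : B != set0.
  rewrite -card_gt0; apply: leq_trans leB.
  by rewrite leq_min ltnS leq0n cardG_gt0.
have CD := cauchy_davenport prH sA sB A0 B0.
have arith k i j a b :
    i < a -> minn k j.+1 <= b -> minn k (i + j).+1 <= minn k (a + b).-1.
  by clear; lia.
by rewrite /= size_cat; apply: leq_trans (arith _ _ _ _ _ oA leB) CD.
Qed.

(* [U^-1] misses [block_sums Ts], whose size is bounded below by
   Cauchy-Davenport. *)
Lemma free_block_bound (S W : seq gT) Ts (U : {set gT}) :
    unit_product_free S -> perm_eq S (flatten Ts ++ W) ->
    (forall T, T \in Ts -> minimal_block T) -> U \subset H -> U != set0 ->
    (forall g, g \in U ->
       exists t u, [/\ perm_eq W (t ++ u), t != [::] & prodl t = g]) ->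
  #|U| + size (flatten Ts) < #|H|.
Proof.
move=> freeS SE Ts_min sUH U0 UW.
have [|sB leB] := @card_block_sums Ts.
  move=> T TTs; split; first exact: Ts_min.
  apply/negP=> /perm_prodsP[t Tt t1]; have [T0 _ _ _] := Ts_min T TTs.
  have [T1 [T2 TsE]] : exists T1 T2, Ts = T1 ++ T :: T2.
    by case/splitPr: TTs => T1 T2; exists T1, T2.
  have /freeS : perm_eq S (t ++ (flatten T1 ++ flatten T2 ++ W)).
    rewrite (permPl SE) TsE flatten_cat /= -!catA perm_catCA.
    by rewrite perm_cat.
  rewrite t1 eqxx => freet; suff /freet : t != [::] by [].
  by move: T0; rewrite -!size_eq0 (perm_size Tt).
have sUV : U^-1 \subset H by rewrite -[gval H]invGid invSg.
(* A common element yields [t] from [W] and [t'] from the blocks with inverse products, so that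
   [t ++ t'] is a nonempty part of [S] with product 1. *)
have disj : U^-1 :&: block_sums Ts = set0.
  apply/setP=> g; rewrite !inE; apply/andP=> -[/UW[t [u [Wt t0 tg]]]].
  case/mem_block_sums=> t' [u' [Tst' t'g]].
  have /freeS : perm_eq S ((t ++ t') ++ (u ++ u')).
    rewrite (permPl SE) (permPl (perm_cat Tst' Wt)).
    by apply/seq.permP=> p; rewrite !count_cat addnACA (addnC (count p t)) (addnC (count p u)).
  rewrite prodl_cat tg t'g mulVg eqxx => freet; suff /freet: t ++ t' != [::] by [].
  by case: (t) t0.
have := cardsUI U^-1 (block_sums Ts); rewrite disj cards0 addn0 card_invg => cardU.
have : #|U^-1 :|: block_sums Ts| <= #|H| by rewrite subset_leq_card // subUset sUV.
have arith k i n b : 0 < i -> minn k n.+1 <= b -> i + b <= k -> i + n < k.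
  by clear; lia.
by rewrite {}cardU; apply: arith => //; rewrite card_gt0.
Qed.

(** A shortest nonempty subsequence with product in [H] is a minimal block. It is removed and the
    rest is treated by induction. *)
Lemma block_decomposition (W : seq gT) : {subset W <= G} ->
  exists Ts R, [/\ perm_eq W (flatten Ts ++ R),
    forall T, T \in Ts -> minimal_block T &
    forall t u, perm_eq R (t ++ u) -> t != [::] -> prodl t \notin H].
Proof.
have [n] := ubnP (size W); elim: n W => // n IHn W ltWn WG.
pose Q (b : (size W).-tuple bool) := (mask b W != [::]) && (prodl (mask b W) \in H).
have [b0 Qb0 | noQ] := pickP Q; last first.
  exists [::], W; split=> // t u Wtu t0; apply/negP=> tH.
  have [b tb] := perm_catP_mask Wtu; have /negP := negbT (noQ b); apply.
  rewrite /Q -(prodl_perm_mem _ tb) ?tH ?andbT; last first.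
    by move=> g gt; rewrite WG // (perm_mem Wtu) mem_cat gt.
  by move: t0; rewrite -!size_eq0 (perm_size tb).
case: (arg_minnP (fun b : (size W).-tuple bool => size (mask b W)) Qb0).
move=> b /andP[b_n0 bH] minb; set T := mask b W in b_n0 bH minb.
have [W' WE] := perm_to_subseq (mask_subseq b W : subseq T W).
have TG : {subset T <= G} by move=> g gT'; rewrite WG // (perm_mem WE) mem_cat gT'.
have [||Ts [R [W'E Ts_min Rfree]]] := IHn W'.
- rewrite -ltnS; apply: leq_trans ltWn; rewrite ltnS (perm_size WE) size_cat.
  by rewrite -[X in X < _]add0n ltn_add2r lt0n size_eq0.
- by move=> g gW'; rewrite WG // (perm_mem WE) mem_cat gW' orbT.
exists (T :: Ts), R; split=> //; first by rewrite (permPl WE) /= -catA perm_cat2l.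
move=> T'; rewrite inE => /predU1P[->|/Ts_min//]; split=> // t u Ttu t0 u0.
apply/negP=> tH; have Wtu : perm_eq W (t ++ (u ++ W')).
  by rewrite (permPl WE) catA perm_cat2r.
have [c tc] := perm_catP_mask Wtu; have := minb c; rewrite /Q -(prodl_perm_mem _ tc); last first.
  by move=> g gt; rewrite WG // (perm_mem Wtu) mem_cat gt.
rewrite tH andbT -size_eq0 -(perm_size tc) size_eq0 t0 (perm_size Ttu) size_cat => /(_ isT).
by rewrite -[X in _ <= X]addn0 leq_add2l leqn0 size_eq0 (negPf u0).
Qed.

Lemma flatten_blocks_mem Ts : (forall T, T \in Ts -> minimal_block T) ->
  prodl (flatten Ts) \in H.
Proof.
elim: Ts => [|T Ts IHTs] Ts_min; first by rewrite prodl_nil group1.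
rewrite /= prodl_cat groupM //; first by case: (Ts_min T (mem_head _ _)).
by apply: IHTs => T' T'Ts; apply: Ts_min; rewrite inE T'Ts orbT.
Qed.

(** Modulo [H] the leftover has the same product as [W], which is trivial, so it must be empty. *)
Lemma full_block_decomposition (W : seq gT) : {subset W <= G} -> prodl W \in H ->
  exists2 Ts, perm_eq W (flatten Ts) & forall T, T \in Ts -> minimal_block T.
Proof.
move=> WG WH; have [Ts [R [WE Ts_min Rfree]]] := block_decomposition WG.
suff R0 : R == [::] by exists Ts => //; rewrite (eqP R0) cats0 in WE.
apply: contraLR WH => R0; rewrite (prodl_perm_mem WG WE) prodl_cat.
rewrite groupMl ?flatten_blocks_mem //; apply: (Rfree R [::]) => //.
by rewrite cats0.
Qed.

(** * The cosets of [H] that contain the terms of an extremal list *)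

Let m := #|G / H|.

(** [Z] is cut into blocks completely, so the leftover of a decomposition of [S] comes from [W]
    alone. The bounds [#|H| - 1] on the block lengths and [m - 1] on the leftover add up to
    [size S], so both are attained. *)
Lemma zero_sum_leftover (S Z W : seq gT) :
    1 < m -> {subset S <= G} -> unit_product_free S ->
    size S = (m + #|H| - 2)%N -> perm_eq S (Z ++ W) -> prodl Z \in H ->
  let u := (coset H (prodl S))^-1 in
  #[u] = m /\ m.-1 <= count (fun g => coset H g == u) W.
Proof.
move=> m_gt1 SG freeS szS SZW ZH u.
have ZG : {subset Z <= G} by move=> g gZ; rewrite SG // (perm_mem SZW) mem_cat gZ.
have WG : {subset W <= G} by move=> g gW; rewrite SG // (perm_mem SZW) mem_cat gW orbT.
have [Ts1 ZE Ts1_min] := full_block_decomposition ZG ZH.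
have [Ts2 [R [WE Ts2_min Rfree]]] := block_decomposition WG.
have SE : perm_eq S (flatten (Ts1 ++ Ts2) ++ R).
  by rewrite (permPl SZW) flatten_cat -catA perm_cat.
have Ts_min T : T \in Ts1 ++ Ts2 -> minimal_block T.
  by rewrite mem_cat => /orP[/Ts1_min|/Ts2_min].
(* One block [T] is set apart: its rearranged products, at least [size T] in number, serve as the
   set [U] of the bound for the remaining blocks. *)
have szTs : size (flatten (Ts1 ++ Ts2)) < #|H|.
  case: (Ts1 ++ Ts2) SE Ts_min => [|T Ts] SE Ts_min; first by rewrite cardG_gt0.
  have minT := Ts_min T (mem_head _ _); have [T0 _ _ _] := minT.
  have PW g : g \in perm_prods T ->
      exists t v, [/\ perm_eq (T ++ R) (t ++ v), t != [::] & prodl t = g].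
    case/perm_prodsP=> t Tt tg; exists t, R; split; rewrite ?perm_cat2r //.
    by move: T0; rewrite -!size_eq0 (perm_size Tt).
  have SE' : perm_eq S (flatten Ts ++ (T ++ R)).
    by rewrite (permPl SE) /= -catA perm_catCA.
  have PT0 : perm_prods T != set0.
    by apply/set0Pn; exists (prodl T); apply/perm_prodsP; exists T.
  have := free_block_bound freeS SE' _ (perm_prods_sub minT) PT0 PW.
  rewrite /= size_cat => /(_ _) lt; apply: leq_ltn_trans (lt _); last first.
    by move=> T' T'Ts; apply: Ts_min; rewrite inE T'Ts orbT.
  rewrite leq_add2r card_perm_prods //; apply/negP=> /PW[t [v [tv t0 t1]]].
  have /freeS : perm_eq S (t ++ (v ++ flatten Ts)).
    by rewrite (permPl SE') perm_catC catA perm_cat2r.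
  by rewrite t1 eqxx => /(_ t0).
have RG : {subset R <= G} by move=> g gR; rewrite WG // (perm_mem WE) mem_cat gR orbT.
pose K := (G / H)%G; pose r := map (coset H) R.
have rK : {subset r <= K} by move=> _ /mapP[g gR ->]; rewrite mem_quotient ?RG.
(* A part of [r] with product 1 lifts to a part of [R] with product in [H], and [R] has none. *)
have freer : unit_product_free r.
  move=> t v /perm_map_lift[R' RR' tvE] t0.
  have RE : perm_eq R (take (size t) R' ++ drop (size t) R') by rewrite cat_take_drop.
  have tE : t = map (coset H) (take (size t) R').
    by rewrite map_take -tvE take_size_cat.
  have tG : {subset take (size t) R' <= G}.
    by move=> g gt; rewrite RG // (perm_mem RE) mem_cat gt.
  rewrite tE -coset_prodl // coset_eq1 ?(prodl_in tG) //; apply: (Rfree _ _ RE).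
  by move: t0; rewrite {1}tE -!size_eq0 size_map.
have ltr : size r < m := free_size rK freer.
have szr : size r = m.-1.
  have arith n k a b : (n + k - 2 = a + b -> a < k -> b < n -> 1 < n -> b = n.-1)%N.
    by clear; lia.
  apply: (arith _ _ _ _ _ szTs ltr m_gt1).
  by rewrite -szS (perm_size SE) size_cat size_map.
have [c rc] : exists c, r = nseq m.-1 c.
  case rE: r (szr) => [|c r']; first by move=> /= ; move: m_gt1; clear; lia.
  move=> szr'; exists c; rewrite -szr'; apply/all_pred1P/allP=> d dr.
  apply/eqP; apply: (free_max_constant cGH rK freer szr); rewrite ?rE //.
  exact: mem_head.
have cK : c \in K by apply: rK; rewrite rc mem_nseq eqxx andbT; move: m_gt1; clear; lia.
have SrE : coset H (prodl S) = c ^+ m.-1.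
  have TsH := flatten_blocks_mem Ts_min.
  rewrite (coset_prodl_perm SG SE) prodl_cat morphM; last first.
  - by rewrite (subsetP sGN) ?prodl_in.
  - by rewrite (subsetP sGN) // (subsetP sHG).
  by rewrite /= coset_id // mul1g coset_prodl // -/r rc prodl_nseq.
(* As [c ^+ m = 1], the inverse of [c ^+ m.-1], the image of the product of [S], is [c]. *)
have cu : c = u.
  apply/eqP; rewrite eq_sym /u SrE eq_invg_mul -expgSr prednK ?(ltnW m_gt1) //.
  by rewrite (expg_cardG cK).
split.
  rewrite -cu; apply/eqP; rewrite eqn_leq dvdn_leq ?cardG_gt0 ?order_dvdG //=.
  (* If the order of [c] were less than [m], then [#[c]] copies of [c] would be a part of [r] with
     product 1. *)
  rewrite leqNgt; apply/negP=> ltc.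
  have /freer : perm_eq r (nseq #[c] c ++ nseq (m.-1 - #[c]) c).
    rewrite -nseqD rc subnKC // -ltnS prednK //.
    exact: ltnW m_gt1.
  rewrite prodl_nseq expg_order eqxx -size_eq0 size_nseq => ord0.
  by have := order_gt0 c; rewrite lt0n => /ord0.
have -> : count (fun g => coset H g == u) W
    = count (fun g => coset H g == u) (flatten Ts2) + count (pred1 u) r.
  by rewrite (seq.permP WE) count_cat count_map.
by rewrite rc cu count_nseq /= eqxx mul1n leq_addl.
Qed.

Lemma coset_prodl_const (s : seq gT) u : {subset s <= G} ->
  all (fun g => coset H g == u) s -> coset H (prodl s) = u ^+ size s.
Proof.
move=> sG su; rewrite coset_prodl // -prodl_nseq -(size_map (coset H)).
congr prodl; apply/all_pred1P/allP=> _ /mapP[g gs ->].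
exact: (allP su).
Qed.

(** Since [u] does not depend on [Z], every [Z] with product in [H] must leave at least [m - 1]
    terms over [u]. Two choices of [Z] give the two claims. *)
Lemma two_coset_structure (S : seq gT) :
    1 < m -> {subset S <= G} -> unit_product_free S ->
    size S = (m + #|H| - 2)%N ->
  exists2 u, #[u] = m &
    count (fun g => coset H g == u) S %% m = m.-1 /\
    (forall g, g \in S -> coset H g != u -> g \in H).
Proof.
move=> m_gt1 SG freeS szS; set u := (coset H (prodl S))^-1; exists u.
  have [] // := @zero_sum_leftover S [::] S; rewrite ?prodl_nil //.
set p := fun g => coset H g == u; set N := count p S.
have leftover Z W : perm_eq S (Z ++ W) -> prodl Z \in H -> #[u] = m /\ m.-1 <= count p W.
  exact: zero_sum_leftover.
have [ou _] : #[u] = m /\ m.-1 <= count p S by apply: (leftover [::]); rewrite ?prodl_nil.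
set F := filter p S; have szF : size F = N by rewrite size_filter.
have SE : perm_eq S (F ++ filter (predC p) S) by rewrite perm_sym perm_filterC.
have FG : {subset F <= G} by move=> g; rewrite mem_filter => /andP[_ /SG].
have cntC : count p (filter (predC p) S) = 0.
  rewrite count_filter; apply/eqP; rewrite -leqn0 leqNgt -has_count.
  by apply/hasPn=> g _ /=; rewrite andbN.
have takeG n : {subset take n F <= G} by move=> g /mem_take; apply: FG.
have prod_take n : n <= N -> coset H (prodl (take n F)) = u ^+ n.
  move=> len; rewrite (@coset_prodl_const _ u) ?size_takel ?szF //.
  by apply/allP=> g /mem_take; rewrite mem_filter => /andP[].
have cnt_drop n : n <= N -> count p (drop n F) = N - n.
  move=> len; rewrite -szF -size_drop; apply/eqP; rewrite -all_count.
  by apply/allP=> g /mem_drop; rewrite mem_filter => /andP[].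
(* Here [Z] takes as many terms over [u] as the largest multiple of [m] allows, leaving [N %% m] of
   them. *)
have Nmod : N %% m = m.-1.
  have leN : N %/ m * m <= N by rewrite leq_trunc_div.
  have [||_] := leftover (take (N %/ m * m) F) (drop (N %/ m * m) F ++ filter (predC p) S).
  - by rewrite catA cat_take_drop.
  - by rewrite -coset_eq1 ?prodl_in // prod_take // mulnC expgM -ou expg_order expg1n.
  rewrite count_cat cntC cnt_drop // addn0 {1}(divn_eq N m) addKn.
  by have := ltn_pmod N (ltnW m_gt1); move: m_gt1; clear; lia.
split=> // g gS gnu; rewrite -coset_eq1 ?SG //; apply: contraT => gn1.
have gK : coset H g \in G / H by rewrite mem_quotient ?SG.
have uK : u \in G / H by rewrite groupV mem_quotient ?prodl_in.
have defK : <[u]> = (G / H)%g.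
  by apply/eqP; rewrite eqEcard cycle_subG uK -/m -ou leqnn.
rewrite -defK in gK; have [j ltj gj] := cyclePmin gK; rewrite ou in ltj.
have j_gt1 : 1 < j.
  by move: gn1 gnu; rewrite gj; case: (j) => [|[|]] //=; rewrite ?expg0 ?expg1 eqxx.
(* A term [g] over [u ^+ j] with [1 < j < m], together with [n] terms over [u], has product in [H];
   this leaves only [j - 1] terms over [u], fewer than [m - 1]. *)
pose n := (m - j + N %/ m * m)%N.
have NE : N = (N %/ m * m + m.-1)%N by rewrite {1}(divn_eq N m) Nmod.
have len : n <= N by rewrite NE /n; move: ltj j_gt1; clear; lia.
have gC : g \in filter (predC p) S by rewrite mem_filter /= gnu.
have SE' : perm_eq S ((g :: take n F) ++ (drop n F ++ rem g (filter (predC p) S))).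
  rewrite (permPl SE) (permPl (perm_cat (perm_refl F) (perm_to_rem gC))).
  by rewrite -cat1s perm_catCA /= perm_cons catA cat_take_drop.
have [|_] := leftover _ _ SE'.
  rewrite -coset_eq1; last first.
    by rewrite prodl_in // => k; rewrite inE => /predU1P[->|/takeG //]; apply: SG.
  rewrite prodl_cons morphM ?(subsetP sGN) ?(prodl_in (takeG n)) ?(SG _ gS) //=.
  rewrite prod_take // gj -expgD /n addnA subnKC ?(ltnW ltj) // expgD mulnC expgM.
  by rewrite -ou !expg_order expg1n mulg1.
rewrite count_cat cnt_drop // (_ : count p (rem _ _) = 0); last first.
  apply/eqP; rewrite -leqn0 -cntC; have /seq.permP -> := perm_to_rem gC.
  by rewrite /= leq_addl.
by rewrite addn0 NE /n; move: (_ * m)%N ltj j_gt1; clear; lia.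
Qed.

(** * Products of [m] terms from a generating coset *)

(** The power [g ^+ m] lies in [H] and commutes with [g], so by [regH] it can only be trivial. *)
Lemma expg_notin g : g \in G -> g \notin H -> g ^+ m = 1.
Proof.
move=> gG gH; apply/eqP; apply: contraR gH => gm1.
apply: (regH gG (h := g ^+ m)); last exact/commuteX/commute_refl.
rewrite !inE gm1 -coset_eq1 ?groupX // morphX ?(subsetP sGN) //=.
by rewrite (expg_cardG (G := (G / H)%G)) ?mem_quotient.
Qed.

Lemma coset_eq_lcoset a b : a \in G -> b \in G -> coset H a = coset H b ->
  b \in a *: H.
Proof.
move=> aG bG ab; rewrite mem_lcoset -coset_eq1 ?groupM ?groupV //.
rewrite morphM ?morphV ?groupV ?(subsetP sGN _ aG) ?(subsetP sGN _ bG) //=.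
by rewrite ab mulVg.
Qed.

Definition sub_products (L : seq gT) (U : {set gT}) : Prop :=
  forall g, g \in U ->
    exists t v, [/\ perm_eq L (t ++ v), t != [::] & prodl t = g].

(** All terms are involutions. The products [g1 * g2] and [g2 * g1] differ, and [g1 * g3] or
    [g2 * g3] is a third value unless [g3 = g1 * g2 * g1 = g2 * g1 * g2]. In that case
    [(g1 * g2) ^+ 3 = g3 * g3 = 1], which forces [#|H| = 3]; this is where the pair (2, 3) is
    excluded. *)
Lemma three_reflections_products (L : seq gT) u :
    m = 2 -> #|H| != 3 -> #[u] = 2 -> size L = 3 -> uniq L ->
    (forall g, g \in L -> g \in G /\ coset H g = u) ->
  exists U : {set gT}, [/\ U \subset H, 2 < #|U| & sub_products L U].
Proof.
move=> m2 H3 ou; case: L => [|g1 [|g2 [|g3 [|]]]] //= _.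
rewrite !inE negb_or -!andbA => /and4P[n12 n13 n23 _] Lu.
have [[G1 u1] [G2 u2] [G3 u3]] : [/\ g1 \in G /\ coset H g1 = u,
    g2 \in G /\ coset H g2 = u & g3 \in G /\ coset H g3 = u].
  by split; apply: Lu; rewrite !inE eqxx ?orbT.
have u_n1 : u != 1 by rewrite -order_eq1 ou.
have NH g : g \in G -> coset H g = u -> g \notin H by move=> gG gu; rewrite -coset_eq1 // gu.
have sq g : g \in G -> coset H g = u -> g * g = 1.
  by move=> gG gu; rewrite -(expg_notin gG (NH g gG gu)) m2 expgS expg1.
have prodH g h : g \in G -> h \in G -> coset H g = u -> coset H h = u -> g * h \in H.
  move=> gG hG gu hu; rewrite -coset_eq1 ?groupM // morphM ?(subsetP sGN) //= gu hu.
  by rewrite -[u * u]/(u ^+ 2) -ou expg_order.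
have nc g h : g \in G -> h \in G -> coset H g = u -> coset H h = u -> g != h ->
    g * h != h * g.
  move=> gG hG gu hu ngh; apply/eqP=> cgh; case/negP: (NH g gG gu).
  apply: (regH gG (h := g * h)); last exact: commuteM.
  rewrite !inE prodH // andbT; apply: contra ngh => /eqP gh1.
  by rewrite -[h]mul1g -(sq g gG gu) -mulgA gh1 mulg1.
have triple (a b c : gT) : uniq [:: a; b; c] ->
    {subset [:: a; b; c] <=
      [:: g1 * g2; g2 * g1; g1 * g3; g3 * g1; g2 * g3; g3 * g2]} ->
  exists U : {set gT}, [/\ U \subset H, 2 < #|U| & sub_products [:: g1; g2; g3] U].
  move=> uabc sabc; exists [set g in [:: a; b; c]]; split.
  - apply/subsetP=> g; rewrite inE => /sabc; rewrite !inE.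
    by do 5![case/orP => [/eqP->|]; first exact: prodH]; move/eqP->; apply: prodH.
  - by rewrite cardsE (card_uniqP uabc).
  have pr2 (g h : gT) : prodl [:: g; h] = g * h.
    by rewrite !prodl_cons prodl_nil mulg1.
  move=> g; rewrite inE => /sabc; rewrite !inE.
  do 5?[case/orP]; move/eqP->.
  - by exists [:: g1; g2], [:: g3].
  - exists [:: g2; g1], [:: g3]; rewrite pr2; split=> //.
    by apply/seq.permP=> p /=; rewrite addnCA.
  - exists [:: g1; g3], [:: g2]; rewrite pr2; split=> //.
    by apply/seq.permP=> p /=; rewrite !addn0 (addnC (p g2)).
  - exists [:: g3; g1], [:: g2]; rewrite pr2; split=> //.
    by apply/seq.permP=> p /=; rewrite !addn0 (addnC (p g2)) addnCA.
  - exists [:: g2; g3], [:: g1]; rewrite pr2; split=> //.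
    by apply/seq.permP=> p /=; rewrite !addn0 addnC addnA.
  exists [:: g3; g2], [:: g1]; rewrite pr2; split=> //.
  by apply/seq.permP=> p /=; rewrite !addn0 addnC (addnC (p g2)) addnA.
have n12c : g1 * g2 != g2 * g1 by apply: nc.
have [E1 | n1] := eqVneq (g1 * g3) (g2 * g1); last first.
  apply: (triple (g1 * g2) (g2 * g1) (g1 * g3)); last first.
    by apply/allP; rewrite /= !inE !eqxx !orbT.
  by rewrite /= !inE negb_or n12c (inj_eq (mulgI _)) n23 eq_sym n1.
have [E2 | n2] := eqVneq (g2 * g3) (g1 * g2); last first.
  apply: (triple (g1 * g2) (g2 * g1) (g2 * g3)); last first.
    by apply/allP; rewrite /= !inE !eqxx !orbT.
  by rewrite /= !inE negb_or n12c (inj_eq (mulgI _)) n13 eq_sym n2.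
have g3E : g3 = g1 * (g2 * g1) by rewrite -E1 mulgA sq // mul1g.
have g3E' : g3 = g2 * (g1 * g2) by rewrite -E2 mulgA sq // mul1g.
have h3 : (g1 * g2) ^+ 3 = 1.
  rewrite !expgS expg0 mulg1 -(sq g3) // {1}g3E g3E' !mulgA //.
have hH : g1 * g2 \in H by apply: prodH.
case/negP: H3; have := order_dvdn (g1 * g2) 3; rewrite h3 eqxx => h_dvd3.
have /primeP[_ /(_ _ (order_dvdG hH))] := prH; case/orP => [|/eqP oh].
  rewrite order_eq1 => /eqP g12; case/eqP: n12.
  by rewrite -[g2]mul1g -(sq g1) // -mulgA g12 mulg1.
by rewrite -oh; move: h_dvd3; rewrite oh dvdn_prime2.
Qed.

(** If [g] fixed or inverted [d], then [g] or [g ^+ 2] would centralize [d] and lie in [H], although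
    [g] has order [m > 2] modulo [H]. *)
Lemma conj_neq g d : 2 < m -> g \in G -> #[coset H g] = m -> d \in H^# ->
  d ^ g != d /\ d ^ g != d^-1.
Proof.
move=> m_gt2 gG og dH.
have notH k : 0 < k < m -> g ^+ k \notin H.
  move=> /andP[k0 ltk]; rewrite -coset_eq1 ?groupX // morphX ?(subsetP sGN) //=.
  by rewrite -order_dvdn og gtnNdvd.
have nfix k : 0 < k < m -> d ^ (g ^+ k) != d.
  move=> /notH; apply: contra => /eqP dk; apply: (regH (h := d)); rewrite ?groupX //.
  by apply/commute_sym/commgP; rewrite commgEl dk mulVg.
split; first by rewrite -[g]expg1 nfix //= ltnW.
have := nfix 2; rewrite m_gt2 => /(_ isT); apply: contra => /eqP dg.
by rewrite expgS expg1 conjgM dg conjVg dg invgK.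
Qed.

(** The list is split into [g] and [m - 1] pairs of unequal terms. A choice from each pair, together
    with [g], has [m] factors over [u], so its product is in [H]. *)
Lemma generator_coset_products (L : seq gT) u :
    2 < m -> m < #|H| -> #[u] = m -> size L = (m.-1).*2.+1 ->
    (forall g, count_mem g L <= m.-1) ->
    (forall g, g \in L -> g \in G /\ coset H g = u) ->
  exists U : {set gT}, [/\ U \subset H, m < #|U| & sub_products L U].
Proof.
move=> m_gt2 mq ou szL cntL Lu.
have [g [ps [LE szps ps_neq]]] := distinct_pairing szL cntL.
have psu p : p \in ps -> [/\ p.1 \in L, p.2 \in L & p.1 != p.2].
  move=> pps; split; last exact: ps_neq.
    rewrite (perm_mem LE) inE; apply/orP; right; apply/flattenP.
    by exists [:: p.1; p.2]; rewrite ?mem_head //; apply: (map_f (fun p => [:: p.1; p.2])).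
  rewrite (perm_mem LE) inE; apply/orP; right; apply/flattenP.
  by exists [:: p.1; p.2]; rewrite ?inE ?eqxx ?orbT //; apply: (map_f (fun p => [:: p.1; p.2])).
have [gG gu] : g \in G /\ coset H g = u by apply: Lu; rewrite (perm_mem LE) mem_head.
case: ps => [|[a a'] [|[b b'] ps]] in LE szps ps_neq psu *;
  try by move: szps m_gt2; case: (m) => [|[|[|]]].
have [aL a'L na] := psu (a, a') (mem_head _ _).
have [|bL b'L nb] := psu (b, b'); first by rewrite !inE eqxx orbT.
have {}Lu h : h \in L -> [/\ h \in G, coset H h = u & h \in 'N(H)].
  by case/Lu=> hG hu; split; rewrite // (subsetP sGN).
have [[aG au aN] [a'G a'u _]] := (Lu a aL, Lu a' a'L).
have [[bG bu bN] [b'G b'u _]] := (Lu b bL, Lu b' b'L).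
have gN : g \in 'N(H) by rewrite (subsetP sGN).
pose pairs := [seq [:: p.1; p.2] | p <- ps].
have sub_pair c c' : c \in G -> c' \in G -> coset H c = u -> coset H c' = u ->
    [set c; c'] \subset c *: H.
  by move=> cG c'G cu c'u; rewrite subUset !sub1set lcoset_refl coset_eq_lcoset // cu.
(* It suffices to order the lists so that two pairs and [g] give a factor [X] with four elements:
   the other [m - 3] pairs raise the count to [m + 1], and [m < #|H|] keeps the cap of
   Cauchy-Davenport above [m]. *)
have finish ls X x : perm_eq L (flatten ls) -> size ls = m ->
    choice_prods ls = X * choice_prods pairs -> X \subset x *: H -> 3 < #|X| ->
  exists U : {set gT}, [/\ U \subset H, m < #|U| & sub_products L U].
  move=> Lls szls lsE sX X4; exists (choice_prods ls).
  have ls_sub : sub_products L (choice_prods ls) /\ choice_prods ls \subset H.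
    split=> [h | ]; last apply/subsetP=> h; case/mem_choice_prods=> t [v [lsE' szt <-]].
      exists t, v; rewrite (permPl Lls); split=> //.
      by rewrite -size_eq0 szt szls -lt0n (ltn_trans _ m_gt2).
    have tL : {subset t <= L}.
      by move=> k kt; rewrite (perm_mem Lls) (perm_mem lsE') mem_cat kt.
    have tG : {subset t <= G} by move=> k /tL/Lu[].
    rewrite -coset_eq1 ?prodl_in // (@coset_prodl_const _ u) // ?szt ?szls -?ou ?expg_order //.
    by apply/allP=> k /tL/Lu[_ -> _].
  have [? ?] := ls_sub; split=> //; rewrite lsE.
  have X0 : X != set0 by rewrite -card_gt0; apply: leq_trans X4.
  have leX : minn #|H| (#|X| + size ps) <= #|X * choice_prods pairs|.
    apply: card_mul_pairs prH sX X0 _ => p p_ps.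
    have [|p1L p2L np] := psu p; first by rewrite !inE p_ps !orbT.
    have [[p1G p1u p1N] [p2G p2u _]] := (Lu _ p1L, Lu _ p2L).
    by split; rewrite ?coset_eq_lcoset // p1u.
  have arith k n i j r :
      (minn k (i + j) <= r -> n < k -> 3 < i -> j.+2 = n.-1 -> 2 < n -> n < r)%N.
    by clear; lia.
  exact: (arith _ _ _ _ _ leX mq X4 szps m_gt2).
have set2E (c c' : gT) : [set h in [:: c; c']] = [set c; c'] by apply/setP=> h; rewrite !inE.
have set1E (c : gT) : [set h in [:: c]] = [set c] by apply/setP=> h; rewrite !inE.
have szls : (size pairs).+3 = m.
  by rewrite size_map; move: szps m_gt2 => /=; clear; case: m => //= k ->.
have sg : [set g] \subset g *: H by rewrite sub1set lcoset_refl.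
have permL (ls : seq (seq gT)) : perm_eq [:: a, a', b, b', g & flatten pairs] (flatten ls) ->
    perm_eq L (flatten ls).
  move=> lsE; rewrite (permPl LE) -(permPr lsE) /= -/pairs.
  by rewrite -[g :: _]cat1s (perm_catCA [:: g] [:: a; a'; b; b'] (flatten pairs)).
have [/andP[n1 n2] | ] := boolP ((a'^-1 * a != b' * b^-1) && (a'^-1 * a != b * b'^-1)).
  apply: (finish [:: [:: a; a'], [:: b; b'], [:: g] & pairs]
            ([set a; a'] * [set b; b'] * [set g]) (a * b * g)) => //.
  - exact: permL.
  - by rewrite /choice_prods !big_cons !set2E set1E !mulgA.
  - by rewrite !mul_coset_sub ?sub_pair.
  by rewrite card_rcoset pair_prods_card.
(* Otherwise insert [g] between the two pairs: this conjugates [d] by [g], which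
   moves it off [d] and [d^-1]. *)
move=> nE; pose d := a'^-1 * a.
have dH : d \in H^#.
  rewrite !inE -eq_mulVg1 eq_sym na /= -coset_eq1 ?groupM ?groupV //.
  by rewrite morphM ?morphV ?groupV ?(subsetP sGN _ a'G) //= au a'u mulVg.
have ogu : #[coset H g] = m by rewrite gu.
have [dg dg'] := conj_neq m_gt2 gG ogu dH.
apply: (finish [:: [:: a; a'], [:: g], [:: b; b'] & pairs]
            ([set a; a'] * [set g] * [set b; b']) (a * g * b)) => //.
- apply: permL => /=; do 2!rewrite perm_cons.
  by rewrite -[[:: b, b', g & _]]/([:: b; b'] ++ [:: g] ++ _) perm_catCA.
- by rewrite /choice_prods !big_cons !set2E set1E !mulgA.
- by rewrite !mul_coset_sub ?sub_pair.
have -> : [set a; a'] * [set g] = [set a * g; a' * g].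
  by apply/setP=> h; rewrite mem_rcoset !inE !(can2_eq (mulgKV g) (mulgK g)).
have dgE : (a' * g)^-1 * (a * g) = d ^ g by rewrite conjgE /d invMg !mulgA.
have eV : b * b'^-1 = (b' * b^-1)^-1 by rewrite invMg invgK.
move: nE; rewrite negb_and !negbK -/d eV => dE.
have eE : b' * b^-1 = d \/ b' * b^-1 = d^-1.
  by case/orP: dE => /eqP->; [left | right; rewrite invgK].
apply: pair_prods_card; rewrite ?(inj_eq (mulIg _)) // dgE ?eV.
  by case: eE => ->.
by case: eE => ->; rewrite ?invgK.
Qed.

(** * The shape of extremal lists and its converse *)

(** Otherwise [2m - 1] terms over [u] can be set apart as [L]. The rest [Z] has product in [H] and
    consists of blocks of total length [#|H| - m - 1], too long beside more than [m] products in [H]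
    from [L]. *)
Lemma generator_coset_count (S : seq gT) u :
    1 < m -> m < #|H| -> (m, #|H|) <> (2, 3) -> {subset S <= G} ->
    unit_product_free S -> size S = (m + #|H| - 2)%N -> #[u] = m ->
    count (fun g => coset H g == u) S %% m = m.-1 ->
    (forall g, g \in S -> coset H g != u -> g \in H) ->
  count (fun g => coset H g == u) S = m.-1.
Proof.
move=> m_gt1 mq m2q3 SG freeS szS ou; set p := fun g => coset H g == u.
set N := count p S => Nmod Sp.
have NE : N = (N %/ m * m + m.-1)%N by rewrite {1}(divn_eq N m) Nmod.
have [k0 | k_gt0] := posnP (N %/ m); first by rewrite NE k0.
set F := filter p S; have szF : size F = N by rewrite size_filter.
pose L := take (m.-1).*2.+1 F.
pose Z := drop (m.-1).*2.+1 F ++ filter (predC p) S.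
have leN : (m.-1).*2.+1 <= N.
  rewrite NE; apply: (@leq_trans (1 * m + m.-1)); last first.
    by rewrite leq_add2r leq_mul2r k_gt0 orbT.
  by rewrite mul1n -addnn; move: m_gt1; clear; case: m => // k _; rewrite addSn.
have szL : size L = (m.-1).*2.+1 by rewrite size_takel ?szF.
have SE : perm_eq S (Z ++ L).
  by rewrite perm_sym perm_catC catA cat_take_drop perm_filterC.
have Fp g : g \in F -> g \in G /\ coset H g = u.
  by rewrite mem_filter => /andP[/eqP gu /SG].
have Lp g : g \in L -> g \in G /\ coset H g = u by move=> /mem_take/Fp.
have ZG : {subset Z <= G} by move=> g gZ; rewrite SG // (perm_mem SE) mem_cat gZ.
have ZH : prodl Z \in H.
  rewrite prodl_cat groupM //; last first.
    by apply: prodl_in => g; rewrite mem_filter => /andP[/= gnu gS]; apply: Sp.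
  have dG : {subset drop (m.-1).*2.+1 F <= G} by move=> g /mem_drop/Fp[].
  rewrite -coset_eq1 ?prodl_in // (@coset_prodl_const _ u) //; last first.
    by apply/allP=> g /mem_drop/Fp[_ ->].
  rewrite -order_dvdn ou size_drop szF.
  have -> : (N - (m.-1).*2.+1 = (N %/ m).-1 * m)%N.
    rewrite {1}NE -{1}(prednK k_gt0) mulSn -addnn.
    move: ((N %/ m).-1 * m)%N m_gt1; clear; case: m => // k j _ /=.
    by lia.
  exact: dvdn_mull.
(* A term over [u] repeated [m] times would have product [g ^+ m = 1]. *)
have cntL g : count_mem g L <= m.-1.
  rewrite leqNgt; apply/negP=> gL.
  have [gG gu] : g \in G /\ coset H g = u.
    by apply: Lp; rewrite -has_pred1 has_count; apply: leq_trans gL.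
  have gH : g \notin H.
    by rewrite -coset_eq1 // gu -order_eq1 ou; move: m_gt1; clear; case: m => [|[]].
  have [s' sS gs] : exists2 s', subseq s' S & perm_eq (nseq m g) s'.
    apply/count_subseqP=> h; rewrite count_nseq (seq.permP SE) count_cat /=.
    have [<-|] := eqVneq g h; last by rewrite mul0n.
    by rewrite mul1n (leq_trans _ (leq_addl _ _)) // -(prednK (ltnW m_gt1)).
  have [v Sv] := perm_to_subseq sS.
  have /freeS : perm_eq S (nseq m g ++ v) by rewrite (permPl Sv) perm_cat2r perm_sym.
  rewrite prodl_nseq expg_notin // eqxx -size_eq0 size_nseq => m0.
  by have := ltnW m_gt1; rewrite lt0n => /m0.
have [U [sUH ltU UL]] : exists U : {set gT}, [/\ U \subset H, m < #|U| & sub_products L U].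
  have [m2 | m_neq2] := eqVneq m 2; last first.
    apply: (generator_coset_products _ mq ou) => //.
    by rewrite ltn_neqAle eq_sym m_neq2.
  rewrite m2; apply: (three_reflections_products m2 _ _ _ _ Lp).
  - by apply/eqP=> H3; case: m2q3; rewrite m2 H3.
  - by rewrite ou.
  - by rewrite szL m2.
  apply: count_mem_uniq => g; have := cntL g; rewrite m2 -has_pred1 has_count.
  by case: (count_mem g L) => [|[]].
have [Ts ZE Ts_min] := full_block_decomposition ZG ZH.
have SE' : perm_eq S (flatten Ts ++ L) by rewrite (permPl SE) perm_cat2r.
have U0 : U != set0 by rewrite -card_gt0; apply: leq_trans ltU.
have := free_block_bound freeS SE' Ts_min sUH U0 UL.
have := perm_size SE'; rewrite szS size_cat szL => szE ltq.
have arith n k a b : (1 < n -> n < k -> n + k - 2 = b + n.-1.*2.+1 -> n < a ->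
   a + b < k -> False)%N by clear; lia.
by case: (arith _ _ _ _ m_gt1 mq szE ltU ltq).
Qed.

(** The terms not over [u] number [#|H| - 1]; being a free list of maximal length in [H], they are
    all equal. *)
Lemma extremal_structure (S : seq gT) :
    1 < m -> m < #|H| -> (m, #|H|) <> (2, 3) -> {subset S <= G} ->
    unit_product_free S -> size S = (m + #|H| - 2)%N ->
  exists h u F, [/\ h \in H^#, #[u] = m, size F = m.-1,
    forall g, g \in F -> g \in G /\ coset H g = u &
    perm_eq S (nseq #|H|.-1 h ++ F)].
Proof.
move=> m_gt1 mq m2q3 SG freeS szS.
have [u ou [Nmod Sp]] := two_coset_structure m_gt1 SG freeS szS.
have cntS := generator_coset_count m_gt1 mq m2q3 SG freeS szS ou Nmod Sp.
set p := fun g => coset H g == u in cntS *; set C := filter (predC p) S.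
have SE : perm_eq S (C ++ filter p S) by rewrite perm_sym perm_catC perm_filterC.
have CH : {subset C <= H} by move=> g; rewrite mem_filter => /andP[/= gnu /Sp]; apply.
have freeC := free_sub freeS SE.
have szC : size C = #|H|.-1.
  have := perm_size SE; rewrite szS size_cat (size_filter p) cntS.
  have arith n k a : (1 < n -> n < k -> n + k - 2 = a + n.-1 -> a = k.-1)%N.
    by clear; lia.
  exact: arith m_gt1 mq.
have cHH : abelian H by apply/cyclic_abelian/prime_cyclic.
have [h hC] : exists h, h \in C.
  have : 0 < size C by rewrite szC -subn1 subn_gt0 prime_gt1.
  by case: (C) => [|h C'] // _; exists h; rewrite mem_head.
have CE : C = nseq #|H|.-1 h.
  rewrite -szC; apply/all_pred1P/allP=> g gC; apply/eqP.
  exact: (free_max_constant cHH CH freeC szC).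
exists h, u, (filter p S); split; rewrite ?size_filter -?CE //; last first.
  by move=> g; rewrite mem_filter => /andP[/eqP gu /SG].
rewrite !inE CH // andbT.
have := freeC [:: h] (rem h C) (perm_to_rem hC) isT.
by rewrite prodl_cons prodl_nil mulg1.
Qed.

(** Modulo [H], a part with product 1 contains a multiple of [#[u]] terms from [F], hence none. What
    remains is a power of [h] with positive exponent below [#[h]]. *)
Lemma extremal_structure_free (S F : seq gT) h k u :
    h \in H -> k < #[h] -> size F < #[u] ->
    (forall g, g \in F -> g \in G /\ coset H g = u) ->
    perm_eq S (nseq k h ++ F) ->
  unit_product_free S.
Proof.
move=> hH ltk ltF Fu SE t v Stv t0; apply/eqP=> t1.
(* If [h] were in [F], then [u = 1], and the bound [size F < #[u]] would make [F] empty. *)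
pose p := pred1 h; have hF : h \notin F.
  apply/negP=> hF; case: (Fu h hF) => _ hu.
  by move: ltF hF; rewrite -hu coset_id // order1 ltnS leqn0 size_eq0 => /eqP->.
have cnt_le q : count q t <= count q (nseq k h ++ F).
  by rewrite -(seq.permP SE) (seq.permP Stv) count_cat leq_addr.
have tF g : g \in t -> g != h -> g \in F.
  move=> gt gh; have : g \in nseq k h ++ F by rewrite -(perm_mem SE) (perm_mem Stv) mem_cat gt.
  by rewrite mem_cat mem_nseq (negPf gh) andbF.
have tG : {subset t <= G}.
  move=> g gt; have [->|gh] := eqVneq g h; first exact: (subsetP sHG).
  by case: (Fu g (tF g gt gh)).
have tE : perm_eq t (filter p t ++ filter (predC p) t) by rewrite perm_sym perm_filterC.
have fG q : {subset filter q t <= G} by move=> g; rewrite mem_filter => /andP[_ /tG].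
have fpE : filter p t = nseq (count p t) h.
  by rewrite -size_filter; apply/all_pred1P; apply: filter_all.
have cntF : count (predC p) t <= size F.
  apply: leq_trans (cnt_le _) _; rewrite count_cat count_nseq /= eqxx mul0n add0n.
  exact: count_size.
have ub1 : u ^+ count (predC p) t = 1.
  have := coset_prodl_perm tG tE; rewrite t1 morph1 prodl_cat morphM; last first.
  - by rewrite (subsetP sGN) // prodl_in.
  - by rewrite (subsetP sGN) // prodl_in.
  rewrite /= fpE prodl_nseq coset_id ?groupX // mul1g -size_filter => ->.
  rewrite (@coset_prodl_const _ u) //; apply/allP=> g.
  by rewrite mem_filter => /andP[/= gh /tF/(_ gh)/Fu[_ ->]].
have b0 : count (predC p) t = 0.
  apply/eqP; move/eqP: ub1; rewrite -order_dvdn; apply: contraLR; rewrite -lt0n => b0.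
  by rewrite gtnNdvd // (leq_ltn_trans cntF).
have tnseq : t = nseq (size t) h.
  by apply/all_pred1P; rewrite all_count -(count_predC p) b0 addn0.
have szt : size t <= k.
  have := cnt_le p; rewrite {1}tnseq count_cat !count_nseq /= eqxx !mul1n.
  by rewrite (count_memPn hF) addn0.
have /eqP := t1; rewrite tnseq prodl_nseq -order_dvdn gtnNdvd //.
  by rewrite lt0n size_eq0.
exact: leq_ltn_trans szt ltk.
Qed.

End ZeroSumBlocks.


Lemma map_preimage (T1 T2 : eqType) (E : T1 -> T2) (P : pred T1) (F : seq T2) :
    (forall f, f \in F -> exists2 n, P n & f = E n) ->
  exists2 s, all P s & F = map E s.
Proof.
elim: F => [|f F IHF] EF; first by exists [::].
have [n Pn ->] := EF f (mem_head _ _).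
have [g gF|s Ps ->] := IHF; first by apply: EF; rewrite inE gF orbT.
by exists (n :: s); rewrite //= Pn.
Qed.

(** * The semidirect product given by its presentation *)

Section SemidirectPresentation.

Variables (q m s : nat) (gT : finGroupType) (G : {group gT}) (x y : gT).
Hypotheses (prq : prime q) (m_gt0 : 0 < m) (ord_s : mult_order_mod q s m).
Hypotheses (defG : G :=: <<[set x; y]>>) (xm : x ^+ m = 1) (yq : y ^+ q = 1).
Hypotheses (yx : y * x = x * y ^+ s) (oG : #|G| = (m * q)%N).

Let H := <[y]>%G.

Lemma presentation_conj : y ^ x = y ^+ s.
Proof. by rewrite conjgE yx mulKg. Qed.

Lemma presentation_norm : <[x]> \subset 'N(H).
Proof. by rewrite /= norms_cycle presentation_conj mem_cycle. Qed.

Lemma presentation_mul : G :=: <[x]> * <[y]>.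
Proof.
rewrite defG -norm_joinEl ?presentation_norm ?cycle_subG //.
by rewrite /cycle joing_idl joing_idr.
Qed.

(** The relations bound the two orders by [m] and [q]; as [G] is the product of the two cyclic
    groups and has [m * q] elements, both bounds are attained. *)
Lemma presentation_orders : #[x] = m /\ #[y] = q.
Proof.
have := mul_cardG <[x]> <[y]>; rewrite -presentation_mul oG => cardE.
have le_x : #[x] <= m by rewrite dvdn_leq // order_dvdn xm.
have le_y : #[y] <= q by rewrite dvdn_leq ?prime_gt0 // order_dvdn yq.
have I_gt0 : 0 < #|<[x]> :&: <[y]>| by apply: cardG_gt0.
have q_gt0 := prime_gt0 prq.
have le_mq : (m * q <= #[x] * #[y])%N by rewrite {1}/order cardE leq_pmulr.
split; apply/eqP; rewrite eqn_leq ?le_x ?le_y /=.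
  rewrite -(leq_pmul2r q_gt0); apply: leq_trans le_mq _.
  by rewrite leq_mul2l le_y orbT.
rewrite -(leq_pmul2l m_gt0); apply: leq_trans le_mq _.
by rewrite leq_mul2r le_x orbT.
Qed.

Lemma presentation_normal : H <| G.
Proof.
rewrite /normal presentation_mul mulG_subr mulG_subG presentation_norm.
exact: normG.
Qed.

Lemma presentation_quotient : (G / H)%g = <[coset H x]>.
Proof.
rewrite presentation_mul quotientMidr quotient_cycle //.
by rewrite -cycle_subG presentation_norm.
Qed.

Lemma presentation_card_quotient : #|G / H| = m.
Proof.
have [_ oy] := presentation_orders.
rewrite card_quotient ?normal_norm ?presentation_normal //.
rewrite -divgS ?normal_sub ?presentation_normal // oG -orderE oy mulnK //.
exact: prime_gt0.
Qed.

(** If [x ^+ a * y ^+ b] commutes with [h], so does [x ^+ a], which acts on [H] by the power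
    [s ^ a]. Since [h] has order [q], this gives [s ^ a = 1] modulo [q], so [m] divides [a] and
    [x ^+ a = 1]. *)
Lemma presentation_centralizer g h :
  g \in G -> h \in H^# -> commute g h -> g \in H.
Proof.
rewrite {1}presentation_mul => /mulsgP[_ _ /cycleP[a ->] /cycleP[b ->] ->].
rewrite !inE => /andP[h1 /cycleP[c hE]] cgh.
have conj_pow k : y ^ (x ^+ k) = y ^+ (s ^ k).
  elim: k => [|k IHk]; first by rewrite conjg1.
  by rewrite expgSr conjgM IHk conjXg presentation_conj -expgM -expnS.
have hx : commute h (x ^+ a).
  rewrite -(mulgK (y ^+ b) (x ^+ a)); apply: commuteM; first exact: commute_sym.
  by rewrite hE; apply/commuteV/commuteX2/commute_refl.
have oh : #[h] = q.
  have : #[h] %| q by rewrite order_dvdn hE -expgM mulnC expgM yq expg1n.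
  by case/primeP: prq => _ /[apply]; rewrite order_eq1 (negPf h1) => /eqP.
have : s ^ a == 1 %[mod q].
  rewrite -oh -eq_expg_mod_order expg1 {1}hE -expgM mulnC expgM -conj_pow -conjXg -hE.
  by apply/eqP/conjg_fixP/commgP.
have [_ sm sk] := ord_s; have -> : s ^ a = s ^ (a %% m) %[mod q].
  rewrite {1}(divn_eq a m) expnD (mulnC _ m) expnM -modnMml -modnXm sm modnXm.
  by rewrite exp1n modnMml mul1n.
move/eqP=> sam.
have [a0 | a_gt0] := posnP (a %% m); last first.
  by case: (sk (a %% m)) => //; rewrite a_gt0 ltn_mod.
by rewrite (divn_eq a m) a0 addn0 mulnC expgM xm expg1n mul1g mem_cycle.
Qed.

End SemidirectPresentation.

Theorem theorem2 (q m s : nat) (gT : finGroupType) (G : {group gT}) (x y : gT)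
    (S : seq gT) :
  prime q -> (2 <= m)%N -> (m %| q.-1)%N ->
  s %% q != 0%N -> mult_order_mod q s m ->
  (m, q) <> (2%N, 3%N) ->
  (* G = C_q \rtimes_s C_m = < x, y | x^m = 1, y^q = 1, yx = xy^s > *)
  G :=: <<[set x; y]>> ->
  x ^+ m = 1 -> y ^+ q = 1 -> y * x = x * y ^+ s -> #|G| = (m * q)%N ->
  {subset S <= G} -> size S = (m + q - 2)%N ->
  product_one_free S <->
  exists (t i : nat) (nu : seq nat),
    [/\ (1 <= t <= q.-1)%N, (1 <= i <= m.-1)%N, coprime i m,
        size nu = m.-1 /\ all (fun n : nat => (n <= q.-1)%N) nu &
        perm_eq S (nseq q.-1 (y ^+ t) ++ [seq x ^+ i * y ^+ n | n <- nu])].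
Proof.
move=> prq m_gt1 m_dvd _ ord_s m2q3 defG xm yq yx oG SG szS.
have m_gt0 : 0 < m by apply: ltnW.
have q_gt0 := prime_gt0 prq; have q_gt1 := prime_gt1 prq.
have mq : m < q.
  by rewrite -(prednK q_gt0) ltnS dvdn_leq // -subn1 subn_gt0.
have [_ oy] := presentation_orders prq m_gt0 defG xm yq yx oG.
pose H := <[y]>%G; have oH : #|H| = q by rewrite -oy.
have nHG : H <| G := presentation_normal defG yx.
have regH := presentation_centralizer prq m_gt0 ord_s defG xm yq yx.
have quoE := presentation_quotient defG yx.
have oGH : #|(G / H)%g| = m := presentation_card_quotient prq m_gt0 defG xm yq yx oG.
have cGH : abelian (G / H) by rewrite quoE cycle_abelian.
have ocx : #[coset H x] = m by rewrite -oGH quoE.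
have prH : prime #|H| by rewrite oH.
have xG : x \in G by rewrite defG mem_gen // !inE eqxx.
have yG : y \in G by rewrite defG mem_gen // !inE eqxx orbT.
have xN : x \in 'N(H) by rewrite (subsetP (normal_norm nHG)).
rewrite product_one_freeP; split=> [freeS | [t [i [nu [t_bd i_bd co_im [sznu _] SE]]]]].
  have [||||h [u [F [hH ou szF Fu SE]]]] :=
    extremal_structure nHG prH cGH regH _ _ _ SG freeS; rewrite ?oGH ?oH //.
  rewrite oGH in ou szF; rewrite oH in SE.
  move: hH; rewrite !inE => /andP[h1 /cyclePmin[t ltt hE]]; rewrite oy in ltt.
  have t_gt0 : 0 < t by rewrite lt0n; apply: contra h1 => /eqP t0; rewrite hE t0.
  (* [F] has [m - 1 > 0] terms, and any of them exhibits [u] as an element of [G / H]. *)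
  have uK : u \in <[coset H x]>.
    case: F szF Fu {SE} => [|f F _ Fu]; first by
      move/esym/eqP; rewrite -subn1 subn_eq0 leqNgt m_gt1.
    have [fG <-] := Fu f (mem_head _ _).
    by rewrite -quoE mem_quotient.
  have [i lti uE] := cyclePmin uK; rewrite ocx in lti.
  have i_gt0 : 0 < i.
    by rewrite lt0n; apply/eqP=> i0; move: ou m_gt1; rewrite uE i0 order1 => <-.
  (* The [i]-th power of a generator of order [m] has order [m / gcd(m, i)], and [u] has order
     [m]. *)
  have co_im : coprime i m.
    have := orderXgcd (coset H x) i; rewrite -uE ou ocx => mE.
    have : (m * gcdn m i == m * 1)%N by rewrite muln1 {1}mE divnK ?dvdn_gcdl.
    by rewrite eqn_pmul2l // gcdnC.
  have [f fF|nu nu_bd FE] := @map_preimage _ _ (fun n => x ^+ i * y ^+ n) (fun n => n <= q.-1) F.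
    have [fG fu] := Fu f fF; have xiG : x ^+ i \in G by rewrite groupX.
    have : f \in x ^+ i *: H.
      by apply: (coset_eq_lcoset nHG) => //; rewrite morphX // fu uE.
    case/lcosetP=> k /cyclePmin[n ltn ->] ->; exists n => //.
    by rewrite -ltnS prednK // -oy.
  exists t, i, nu; split; rewrite -?FE -?hE //.
  - by rewrite t_gt0 -ltnS prednK.
  - by rewrite i_gt0 -ltnS prednK.
  - by rewrite -szF FE size_map.
(* For the converse, [y ^+ t] has order [q] because [q] is prime and [0 < t < q], and the image of
   [x ^+ i] has order [m] because [i] is coprime to [m]. *)
apply: (extremal_structure_free nHG cGH _ _ _ _ SE (u := coset H x ^+ i)).
- exact: mem_cycle.
- rewrite orderXgcd oy.
  have /eqP -> : coprime q t.
    rewrite prime_coprime // gtnNdvd //; case/andP: t_bd => // _.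
    by rewrite -ltnS prednK.
  by rewrite divn1 prednK.
- by rewrite size_map sznu orderXgcd ocx gcdnC (eqP co_im) divn1 prednK.
move=> _ /mapP[n _ ->]; rewrite groupM ?groupX //; split=> //.
have ynH : y ^+ n \in H by apply: mem_cycle.
have xiN : x ^+ i \in 'N(H) by rewrite groupX.
by rewrite morphM ?(subsetP (normG H) _ ynH) //= morphX // (coset_id ynH) mulg1.
Qed.
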